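(* Let $C$ be a binary singly even self-dual $[106,53,18]$ code whose shadow $S$ has minimum weight at least $5$, with weight enumerators of $C$ and $S$ of the form $$\begin{aligned}W_C=&\,1+(35245 + 2 d )y^{18}+(416262 + 128 c - 2 d )y^{20}+(6586310 + 8192 b - 896 c - 34 d )y^{22}\\&+(86626645 + 524288 a - 106496 b + 1024 c + 34 d )y^{24}+ \cdots,\end{aligned}$$ $$W_S=a y^5+(- 24 a - b )y^9+( 276 a + 22 b + c )y^{13}+(- 2024 a - 231 b - 20 c - d )y^{17}+ \cdots,$$ where $a,b,c,d$ are integers and the dots denote terms of higher degree. Then $d$ is an even integer.
   Context: All codes are binary: a code of length $n$ is a subspace of $\mathbb{F}_2^n$, and $[n,k,d]$ denotes length $n$, dimension $k$, minimum weight $d$. A code $C$ is self-dual if $C=C^\perp$ with respect to the standard inner product. A self-dual code is singly even if it contains a codeword of weight $\equiv 2 \pmod 4$. For a singly even self-dual code $C$, let $C_0$ be the subcode of codewords of weight $\equiv 0 \pmod 4$; the shadow of $C$ is $S=C_0^\perp\setminus C$. The weight enumerators are $W_C=\sum_i A_i y^i$ and $W_S=\sum_i B_i y^i$, where $A_i$ and $B_i$ are the numbers of vectors of weight $i$ in $C$ and $S$, respectively. Every singly even self-dual $[106,53,18]$ code with shadow of minimum weight at least $5$ has weight enumerators of the displayed form for some integers $a,b,c,d$. *)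

(* Defs.v *)
From mathcomp Require Import all_boot all_algebra.

Set Implicit Arguments.
Unset Strict Implicit.
Unset Printing Implicit Defensive.

Import GRing.Theory.
Local Open Scope ring_scope.

Section BinaryCodes.

Variable n : nat.
Implicit Types (x y : 'rV['F_2]_n) (A : {pred 'rV['F_2]_n}).
Implicit Type C : {vspace 'rV['F_2]_n}.

Definition wt x : nat := #|[set i | x 0 i != 0]|.

Definition dot x y : 'F_2 := \sum_(i < n) x 0 i * y 0 i.

(* The dual and the weight enumerator are defined for arbitrary sets of
   vectors, so that they apply to codes, to the subcode C_0 (kept as a set) and
   to the shadow (which is not linear). *)
Definition dual A : {set 'rV['F_2]_n} :=
  [set y | [forall x in A, dot x y == 0]].

Definition weight_enum A : {poly int} :=
  \sum_(i < n.+1) (#|[set x in A | wt x == i]|)%:Z%:P * 'X^i.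

Definition min_weight C (d : nat) : Prop :=
  (exists x, [/\ x \in C, x != 0 & wt x = d]) /\
  (forall x, x \in C -> x != 0 -> (d <= wt x)%N).

Definition nkd_code (k d : nat) C : Prop := \dim C = k /\ min_weight C d.

Definition self_dual C : Prop := C =i dual C.

Definition singly_even C : Prop :=
  exists2 x, x \in C & (wt x = 2 %[mod 4])%N.

Definition doubly_even_part C : {set 'rV['F_2]_n} :=
  [set x in C | (4 %| wt x)%N].

Definition shadow C : {set 'rV['F_2]_n} :=
  dual (doubly_even_part C) :\: [set x in C].

End BinaryCodes.

(* Main.v *)
Require Import Defs.
From mathcomp Require Import all_boot all_algebra finfield zify ring.

(* For a fixed coordinate i put f(x) = 106 x_i - wt(x).  The shadow S consists
   of the s with (-1)^(s.c) = i^(wt c) for all c in C, so by character sums the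
   number of s in S containing a set J with |J| <= 18 is |C| / 2^|J|, except
   that it is 0 when J supports a codeword of weight 18.  Since f has mean 0 on the
   J of given size, the sum over S of f(s) P(wt s) vanishes for deg P < 17, and
   for deg P = 17 it is a multiple of the sum of f over the codewords of weight
   18, which is even.  Take for P the polynomial with roots 21, 25, ..., 85:
   only the weights 5, 9, 13, 17 and their complements survive, and

     B_17(f) + 18 B_13(f) + 171 B_9(f) + 1140 B_5(f) = sum of f over C_18,

   where B_w(f) is the sum of f over the vectors of weight w in S.  As f is odd
   on S, B_17 + B_9 is even, and B_17 + B_9 has the parity of d. *)

Set Implicit Arguments.
Unset Strict Implicit.
Unset Printing Implicit Defensive.

Import GRing.Theory Num.Theory.
Local Open Scope ring_scope.

Lemma sum_antisym (I : finType) (P : {pred I}) (h : I -> I) (F : I -> int) :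
    involutive h -> (forall x, P (h x) = P x) ->
    (forall x, P x -> F (h x) = - F x) ->
  \sum_(x | P x) F x = 0.
Proof.
move=> hK hP hF; set s := \sum_(x | P x) F x.
suff: s = - s by lia.
rewrite {1}/s (reindex_inj (inv_inj hK)) -sumrN (eq_bigl P) //.
exact: eq_bigr.
Qed.

(** * Moments against falling factorials *)

Section ShiftedFactorials.

Variables (I : finType) (P : {pred I}) (g : I -> int) (k : I -> nat) (N : nat).

Hypothesis low_moments :
  forall j, (j < N)%N -> \sum_(x | P x) g x * ((k x) ^_ j)%:Z = 0.

(* Since [(k - l) k^_j = k^_(j+1) + (j - l) k^_j], a product of [N] linear
   factors in [k] has the same moment as its leading term [k^_N]. *)
Lemma moment_prod (ls : seq int) (j : nat) : (size ls + j <= N)%N ->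
  \sum_(x | P x) g x * (\prod_(l <- ls) ((k x)%:Z - l) * ((k x) ^_ j)%:Z) =
  if (size ls + j == N)%N then \sum_(x | P x) g x * ((k x) ^_ N)%:Z else 0.
Proof.
elim: ls j => [|l ls IH] j /= le_jN.
  rewrite (eq_bigr (fun x => g x * ((k x) ^_ j)%:Z)) => [|x _]; last first.
    by rewrite big_nil mul1r.
  case: eqP => [<-//|neq]; apply: low_moments; lia.
rewrite (eq_bigr (fun x =>
    g x * (\prod_(l <- ls) ((k x)%:Z - l) * ((k x) ^_ j.+1)%:Z) +
    (j%:Z - l) *
      (g x * (\prod_(l <- ls) ((k x)%:Z - l) * ((k x) ^_ j)%:Z)))); last first.
  move=> x _; rewrite big_cons ffactnSr PoszM.
  case: (leqP j (k x)) => [le_jk | lt_kj]; first by rewrite -subzn //; ring.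
  by rewrite ffact_small // !(mul0r, mulr0, addr0).
rewrite big_split -mulr_sumr /= IH; last lia.
rewrite IH; last lia.
rewrite addSnnS [(size ls + j == N)%N](_ : _ = false) ?mulr0 ?addr0 //; lia.
Qed.

End ShiftedFactorials.

(* Normalised so that it sums to 0 over the subsets of given size. *)
Definition dev (I : finType) (i : I) (A : {set I}) : int :=
  #|I|%:Z * (i \in A)%:Z - #|A|%:Z.

Lemma devC (I : finType) (i : I) (A : {set I}) : dev i (~: A) = - dev i A.
Proof. by rewrite /dev inE; have := cardsC A; case: (i \in A) => /=; lia. Qed.

(** * Sums of [dev] over the subsets of given size *)

Lemma card_draws_in (I : finType) (i : I) (A : {set I}) (j : nat) :
  #|[set J : {set I} | (J \subset A) && (#|J| == j.+1) && (i \in J)]| =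
  ((i \in A) * 'C(#|A|.-1, j))%N.
Proof.
have split_i := cardsID [set J : {set I} | i \in J]
  [set J : {set I} | (J \subset A) && (#|J| == j.+1)].
rewrite cards_draws in split_i.
have out_i : [set J : {set I} | (J \subset A) && (#|J| == j.+1)] :\:
    [set J : {set I} | i \in J] =
    [set J : {set I} | (J \subset A :\ i) && (#|J| == j.+1)].
  apply/setP=> J; rewrite !inE subsetD1.
  by case: (J \subset A); case: (i \in J).
rewrite out_i cards_draws in split_i.
rewrite (_ : [set J | _] = [set J : {set I} | (J \subset A) && (#|J| == j.+1)]
    :&: [set J : {set I} | i \in J]); last by apply/setP=> J; rewrite !inE.
have := cardsD1 i A; case: (i \in A) => /= cardA.
  move: split_i; rewrite cardA /= add1n binS mul1n. rewrite add0n; lia.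
move: split_i; rewrite cardA add0n mul0n => /eqP.
by rewrite -{2}['C(_, _)]add0n eqn_add2r => /eqP.
Qed.

(** Both terms of [dev] produce the same binomial, because (j+1) C(m, j+1) = m C(m-1, j). *)
Lemma sum_dev_draws (I : finType) (i : I) (A : {set I}) (j : nat) :
  \sum_(J : {set I} | (J \subset A) && (#|J| == j.+1)) dev i J =
  dev i A * 'C(#|A|.-1, j)%:Z.
Proof.
rewrite /dev (eq_bigr (fun J : {set I} =>
  #|I|%:Z * (i \in J)%:Z - j.+1%:Z)); last by move=> J /andP[_ /eqP->].
rewrite big_split /= -mulr_sumr sumr_const.
have := cards_draws A j.+1; rewrite cardsE => ->.
rewrite (_ : \sum_(J | _) _ = ((i \in A) * 'C(#|A|.-1, j))%N%:Z); last first.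
  rewrite -card_draws_in -sum1_card /=.
  rewrite -[RHS]natz natr_sum big_mkcond [RHS]big_mkcond /=.
  apply: eq_bigr => J _; rewrite inE.
  by case: (J \subset A); case: (_ == _); case: (i \in J).
have diag : j.+1%:Z * 'C(#|A|, j.+1)%:Z = #|A|%:Z * 'C(#|A|.-1, j)%:Z.
  by rewrite -!PoszM mul_bin_diag.
by rewrite mulNrn -mulr_natr natz diag PoszM; ring.
Qed.

(** * Supports, weights and characters of binary vectors *)

Section Vectors.

Variable n : nat.
Implicit Types (x y z : 'rV['F_2]_n) (J : {set 'I_n}).

Definition supp x : {set 'I_n} := [set i | x 0 i != 0].
Definition vec J : 'rV['F_2]_n := \row_i (i \in J)%:R.
Definition chi x y : int := (-1) ^+ #|supp x :&: supp y|.

Lemma F2P (a : 'F_2) : a = 0 \/ a = 1.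
Proof. by case: a => [[|[|[]]]] // ?; [left | right]; apply: val_inj. Qed.

Lemma addF2 (V : lmodType 'F_2) (v : V) : v + v = 0.
Proof.
by rewrite -[v]scale1r -scalerDl (_ : 1 + 1 = 0) ?scale0r //; apply: val_inj.
Qed.

Lemma vecK : cancel vec supp.
Proof. by move=> J; apply/setP=> i; rewrite inE mxE; case: (i \in J). Qed.

Lemma suppK : cancel supp vec.
Proof.
by move=> x; apply/rowP=> i; rewrite mxE inE; case: (F2P (x 0 i)) => ->.
Qed.

Lemma supp0 : supp 0 = set0.
Proof. by apply/setP=> i; rewrite !inE mxE eqxx. Qed.

(** Taking [J] full gives the weight of a sum; taking [J] the support of a third vector makes [chi]
    multiplicative. *)
Lemma card_suppD x y J :
  (#|supp (x + y) :&: J| + 2 * #|supp x :&: supp y :&: J| =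
   #|supp x :&: J| + #|supp y :&: J|)%N.
Proof.
rewrite -!sum1_card !(big_mkcond (fun i => i \in _)) big_distrr -!big_split /=.
apply: eq_bigr => i _; rewrite !inE mxE.
by case: (F2P (x 0 i)) => ->; case: (F2P (y 0 i)) => ->; case: (i \in J).
Qed.

Lemma wtD x y : (wt (x + y) + 2 * #|supp x :&: supp y| = wt x + wt y)%N.
Proof. by have := card_suppD x y setT; rewrite !setIT. Qed.

Lemma dotE x y : dot x y = #|supp x :&: supp y|%:R.
Proof.
rewrite /dot -sum1_card natr_sum [RHS]big_mkcond /=.
apply: eq_bigr => i _; rewrite !inE.
by case: (F2P (x 0 i)) => ->; case: (F2P (y 0 i)) => ->;
  rewrite ?mulr0 ?mul0r ?mulr1.
Qed.

Lemma dot_eq0 x y : (dot x y == 0) = ~~ odd #|supp x :&: supp y|.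
Proof. by rewrite dotE -(dvdn_pcharf (pchar_Fp (isT : prime 2))) dvdn2. Qed.

Lemma chi_dot x y : chi x y = if dot x y == 0 then 1 else -1.
Proof. by rewrite dot_eq0 /chi -signr_odd; case: odd. Qed.

Lemma chi_sym x y : chi x y = chi y x.
Proof. by rewrite /chi setIC. Qed.

Lemma chiD x y z : chi (x + y) z = chi x z * chi y z.
Proof. by rewrite /chi -exprD -card_suppD exprD exprM sqrrN !expr1n mulr1. Qed.

Lemma chi_sqr x y : chi x y * chi x y = 1.
Proof. by rewrite /chi -exprD addnn -muln2 mulnC exprM sqrrN !expr1n. Qed.

Lemma supp_eq0 x : (supp x == set0) = (x == 0).
Proof. by rewrite -supp0 (inj_eq (can_inj suppK)). Qed.

(** Flipping in [y] a coordinate from the support of [x] negates [chi x y]. *)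
Lemma sum_chi x : \sum_y chi x y = (x == 0)%:Z * 2 ^+ n.
Proof.
have [->|nz_x] := eqVneq x 0.
  rewrite (eq_bigr (fun=> 1)) => [|y _]; last first.
    by rewrite /chi supp0 set0I cards0.
  by rewrite sumr_const card_mx card_Fp // mul1n mul1r natrX.
rewrite mul0r; have [i x_i] : exists i, i \in supp x.
  by apply/set0Pn; rewrite supp_eq0.
apply: (sum_antisym (h := +%R^~ (vec [set i]))) => // y.
  by rewrite -addrA addF2 addr0.
move=> _; rewrite chi_sym chiD (chi_sym y) [chi (vec _) x]/chi vecK.
by rewrite (setIidPl _) ?sub1set // cards1 mulrN1.
Qed.

End Vectors.

(** * The shadow through character sums *)

Section SelfDual.

Variables (n : nat) (C : {vspace 'rV['F_2]_n}).
Hypothesis sdC : self_dual C.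
Implicit Types (c s : 'rV['F_2]_n) (J : {set 'I_n}).

(* This is i^(wt c), as codewords have even weight. *)
Definition zeta c : int := (-1) ^+ (wt c)./2.

Lemma mem_self_dual s : (s \in C) = [forall c in C, dot c s == 0].
Proof. by rewrite sdC inE. Qed.

Lemma even_wt_code c : c \in C -> ~~ odd (wt c).
Proof.
move=> Cc; move: (Cc); rewrite mem_self_dual => /forall_inP /(_ _ Cc).
by rewrite dot_eq0 setIid.
Qed.

Lemma zeta_dvd4 c : c \in C -> zeta c = if (4 %| wt c)%N then 1 else -1.
Proof.
move=> /even_wt_code ev; rewrite /zeta -signr_odd.
rewrite (_ : (4 %| wt c)%N = ~~ odd (wt c)./2); first by case: odd.
lia.
Qed.

Lemma code_capE c1 c2 : c1 \in C -> c2 \in C ->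
  ~~ odd #|supp c1 :&: supp c2|.
Proof.
move=> Cc1; rewrite mem_self_dual => /forall_inP /(_ _ Cc1).
by rewrite dot_eq0.
Qed.

(** Two codewords meet in an even number of coordinates, so their weights add modulo 4. *)
Lemma zetaD c1 c2 : c1 \in C -> c2 \in C -> zeta (c1 + c2) = zeta c1 * zeta c2.
Proof.
move=> Cc1 Cc2; have ev := code_capE Cc1 Cc2.
have := wtD c1 c2; have := even_wt_code Cc1; have := even_wt_code Cc2.
rewrite /zeta -exprD => ev1 ev2 wtE; rewrite -signr_odd -[RHS]signr_odd.
by congr (_ ^+ nat_of_bool _); lia.
Qed.

Hypothesis seC : singly_even C.

(** A shadow vector is not orthogonal to some codeword [c1], which then has weight 2 mod 4; adding
    [c1] moves any other codeword of weight 2 mod 4 into C_0. Conversely, a codeword of weight 2 mod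
    4 keeps [s] out of [C]. *)
Lemma mem_shadow s : (s \in shadow C) = [forall c in C, chi c s == zeta c].
Proof.
rewrite !inE mem_self_dual; apply/andP/forall_inP => [[]|sC].
  rewrite negb_forall => /existsP[c1]; rewrite negb_imply => /andP[Cc1 c1s].
  move=> /forall_inP s0 c Cc; rewrite zeta_dvd4 // chi_dot.
  have doubly c' : c' \in C -> (4 %| wt c')%N -> dot c' s = 0.
    move=> Cc' d4; by apply/eqP/s0; rewrite inE Cc'.
  have z1 : zeta c1 = -1.
    rewrite zeta_dvd4 //; case: ifP => // /(doubly _ Cc1) e.
    by rewrite e eqxx in c1s.
  have [d4|nd4] := boolP (4 %| wt c)%N; first by rewrite doubly ?eqxx.
  have dot0 : dot (c + c1) s = 0.
    apply: doubly; first exact: rpredD.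
    have := zetaD Cc Cc1; rewrite z1 !zeta_dvd4 ?rpredD // (negPf nd4).
    by case: ifP.
  have := chiD c c1 s; rewrite !chi_dot (negPf c1s) dot0 eqxx.
  by case: ifP.
split.
  have [c Cc wtc] := seC.
  apply/negP => /forall_inP /(_ _ Cc) cs; move/eqP: (sC _ Cc).
  by rewrite chi_dot cs zeta_dvd4 // /dvdn wtc.
apply/forall_inP => c; rewrite inE => /andP[Cc d4]; move/eqP: (sC _ Cc).
by rewrite zeta_dvd4 // d4 chi_dot; case: ifP.
Qed.

(** As a function of [c], the summand is a character of [C], trivial exactly for [s] in the shadow;
    otherwise translation by some [c1] of value -1 cancels the sum. *)
Lemma sum_code_zeta_chi s :
  \sum_(c in C) zeta c * chi c s = (s \in shadow C)%:Z * #|C|%:Z.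
Proof.
have [sS|] := boolP (s \in shadow C).
  rewrite mul1r -[RHS]natz -sumr_const; apply: eq_bigr => c Cc.
  move: sS; rewrite mem_shadow => /forall_inP /(_ _ Cc) /eqP <-.
  exact: chi_sqr.
rewrite mem_shadow negb_forall => /existsP[c1]; rewrite negb_imply mul0r.
move=> /andP[Cc1 c1s].
apply: (sum_antisym (h := +%R^~ c1)) => [c|c|c Cc].
- by rewrite -addrA addF2 addr0.
- by apply: rpredDr.
rewrite zetaD // chiD; move: c1s; rewrite chi_dot zeta_dvd4 //.
by do 2!case: ifP => // _; lia.
Qed.

(** Expand the indicator of the shadow by the previous sum over [C] and exchange: by orthogonality
    only [c = u] survives. *)
Lemma sum_shadow_chi u :
  #|C|%:Z * \sum_(s in shadow C) chi u s = (u \in C)%:Z * (zeta u * 2 ^+ n).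
Proof.
rewrite big_mkcond mulr_sumr /=.
rewrite (eq_bigr (fun s => \sum_(c in C) zeta c * chi (c + u) s)); last first.
  move=> s _; rewrite (eq_bigr (fun c => zeta c * chi c s * chi u s)).
    by rewrite -mulr_suml sum_code_zeta_chi; case: ifP => _;
      rewrite ?mulr0 ?mul0r // mul1r.
  by move=> c _; rewrite chiD mulrA.
rewrite exchange_big /=.
rewrite (eq_bigr (fun c => (c == u)%:Z * (zeta u * 2 ^+ n))); last first.
  move=> c _; rewrite -mulr_sumr sum_chi addr_eq0.
  rewrite (_ : - u = u); last by apply/eqP; rewrite eq_sym -addr_eq0 addF2.
  by case: eqP => [->|]; rewrite !(mul0r, mul1r, mulr0).
have [Cu|nCu] := boolP (u \in C).
  rewrite (bigD1 u) //= eqxx big1 ?addr0 // => c /andP[_ /negPf->].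
  by rewrite mul0r.
rewrite mul0r big1 // => c Cc; case: eqP nCu => [<-|]; first by rewrite Cc.
by rewrite mul0r.
Qed.

End SelfDual.

(** * Binomial moments of the weight over the shadow *)

Section ShadowMoments.

Variables (n : nat) (C : {vspace 'rV['F_2]_n}) (w : nat).
Hypotheses (sdC : self_dual C) (seC : singly_even C).
Hypothesis min_wt : forall c, c \in C -> c != 0 -> (w <= wt c)%N.
Implicit Types (s : 'rV['F_2]_n) (i : 'I_n) (J : {set 'I_n}).

(** Expand the product over [J] of 1 - (-1)^(s_i), whose factors are 2 on the support of [s] and 0
    off it. *)
Lemma subset_supp_chi J s :
  2 ^+ #|J| * (J \subset supp s)%:Z =
  \sum_(K : {set 'I_n} | K \subset J) (-1) ^+ #|K| * chi (vec K) s.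
Proof.
pose sg i : int := if i \in supp s then 1 else -1.
have prod_sg (K : {set 'I_n}) :
    \prod_(i in K) sg i = (-1) ^+ #|K| * chi (vec K) s.
  rewrite /chi vecK -exprD -(cardsID (supp s) K) addnAC addnn -muln2 mulnC.
  rewrite exprD exprM sqrrN !expr1n mul1r (bigID (mem (supp s))) /=.
  rewrite big1 ?mul1r => [|i /andP[_ si]]; last by rewrite /sg si.
  rewrite -prodr_const; apply: eq_big => [i|i /andP[_ /negPf si]].
    by rewrite in_setD andbC.
  by rewrite /sg si.
rewrite -(eq_bigr _ (fun K _ => prod_sg K)).
(* Factors outside [J] are 1, so the product may run over all coordinates; in its expansion the sets
   not inside [J] contribute 0. *)
transitivity (\prod_i ((i \in J)%:Z * sg i + 1)); last first.
  rewrite bigA_distr [RHS]big_mkcond /=; apply: eq_bigr => K _.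
  rewrite -big_mkcond; case: ifP => [/subsetP sKJ|/negbT /subsetPn[i Ki nJi]].
    by apply: eq_bigr => i /sKJ ->; rewrite mul1r.
  by rewrite (bigD1 i) //= (negPf nJi) !mul0r.
rewrite (bigID (mem J)) /= [X in _ = _ * X]big1 ?mulr1; last first.
  by move=> i /negPf->; rewrite mul0r.
case: subsetP => [sJs|/subsetP/subsetPn[i Ji nsi]].
  rewrite mulr1 -prodr_const; apply: eq_bigr => i Ji.
  by rewrite Ji /sg sJs.
by rewrite mulr0 (bigD1 i) //= Ji /sg (negPf nsi) mul0r.
Qed.

(** In the expansion over subsets [K] of [J], a nonempty proper [K] is too small to support a
    codeword; the empty set gives 1 and [J] itself the second term. *)
Lemma card_shadow_above J : J != set0 -> (#|J| <= w)%N ->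
  #|C|%:Z * 2 ^+ #|J| * (\sum_(s in shadow C) (J \subset supp s)%:Z) =
  2 ^+ n * (1 + (vec J \in C)%:Z * ((-1) ^+ #|J| * zeta (vec J))).
Proof.
move=> nz_J leJw; rewrite -mulrA mulr_sumr.
rewrite (eq_bigr _ (fun s _ => subset_supp_chi J s)) exchange_big /= mulr_sumr.
rewrite (eq_bigr (fun K : {set 'I_n} => 2 ^+ n *
    ((vec K \in C)%:Z * ((-1) ^+ #|K| * zeta (vec K))))); last first.
  move=> K _; rewrite -mulr_sumr mulrCA sum_shadow_chi //; ring.
rewrite -mulr_sumr (bigD1 J) //= (bigD1 set0) ?sub0set 1?eq_sym //=.
rewrite big1 ?addr0 => [|K /andP[/andP[sKJ neKJ] nzK]].
  rewrite addrC (_ : vec set0 = 0) ?rpred0; last by rewrite -supp0 suppK.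
  by rewrite cards0 /zeta /wt -/(supp _) supp0 cards0 !mul1r.
have [CK|_] := boolP (vec K \in C); last by rewrite mul0r.
have: (w <= #|K|)%N.
  rewrite -(vecK K); apply: min_wt => //; by rewrite -supp_eq0 vecK.
have : (#|K| < #|J|)%N by apply: proper_card; rewrite properEneq neKJ.
lia.
Qed.

(** The binomial sums [dev] over the (j+1)-subsets of the support of [s]. After exchanging the sums,
    the constant term of the count above [J] disappears since [dev] has total 0, leaving the [J]
    that support codewords. *)
Lemma shadow_moment i j : (j < w)%N ->
  #|C|%:Z * 2 ^+ j.+1 *
    (\sum_(s in shadow C) dev i (supp s) * 'C((wt s).-1, j)%:Z) =
  2 ^+ n * \sum_(c in C | wt c == j.+1)
    dev i (supp c) * ((-1) ^+ j.+1 * zeta c).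
Proof.
move=> lt_jw.
rewrite (eq_bigr (fun s => \sum_(J : {set 'I_n} | #|J| == j.+1)
    dev i J * (J \subset supp s)%:Z)); last first.
  move=> s _; rewrite -sum_dev_draws big_mkcondl /=; apply: eq_bigr => J _.
  by case: ifP; rewrite ?mulr1 ?mulr0.
rewrite exchange_big /= mulr_sumr.
rewrite (eq_bigr (fun J => 2 ^+ n * dev i J + 2 ^+ n * (if vec J \in C then 
    dev i J * ((-1) ^+ j.+1 * zeta (vec J)) else 0))); last first.
  move=> J /eqP cardJ; rewrite -mulr_sumr mulrCA -{1}cardJ card_shadow_above.
  - rewrite cardJ; case: ifP => _; rewrite ?mul1r ?mul0r; ring.
  - by rewrite -card_gt0 cardJ.
  - by rewrite cardJ.
have dev0 : \sum_(J : {set 'I_n} | #|J| == j.+1) dev i J = 0.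
  have devT : dev i [set: 'I_n] = 0 by rewrite /dev inE cardsT mulr1 subrr.
  have draws := sum_dev_draws i [set: 'I_n] j; rewrite devT mul0r in draws.
  by apply: etrans draws; apply: eq_bigl => J; rewrite subsetT.
rewrite big_split -!mulr_sumr /= dev0 mulr0 add0r; congr (_ * _).
rewrite -big_mkcondr (reindex_onto (@supp n) (@vec n)) /=; last first.
  by move=> J _; rewrite vecK.
apply: eq_big => [c|c _]; last by rewrite suppK.
by rewrite suppK eqxx andbT andbC.
Qed.

End ShadowMoments.

(** * Shadow weights modulo 4 and complementation *)

Section ShadowWeights.

Variables (n : nat) (C : {vspace 'rV['F_2]_n}).
Hypotheses (sdC : self_dual C) (seC : singly_even C).
Implicit Types (s : 'rV['F_2]_n) (i : 'I_n).

(** The difference c of two shadow vectors lies in [C], and c meets [s1] in a number of coordinates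
    of the parity of wt(c)/2, so adding c preserves the weight modulo 4. *)
Lemma shadow_wt_mod4 s1 s2 : s1 \in shadow C -> s2 \in shadow C ->
  (wt s1 = wt s2 %[mod 4])%N.
Proof.
rewrite !mem_shadow // => /forall_inP S1 /forall_inP S2.
have C12 : s1 + s2 \in C.
  rewrite (mem_self_dual sdC); apply/forall_inP => c Cc.
  have: chi c (s1 + s2) = 1.
    rewrite chi_sym chiD !(chi_sym _ c) (eqP (S1 c Cc)) -(eqP (S2 c Cc)).
    exact: chi_sqr.
  by rewrite chi_dot; case: ifP.
have := wtD s1 (s1 + s2); rewrite addrA addF2 add0r => wtE.
have := even_wt_code sdC C12; move/eqP: (S1 _ C12); rewrite /chi /zeta.
rewrite setIC -signr_odd -[RHS]signr_odd => + ev.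
move/eqP; rewrite (inj_eq signr_inj) => /eqP; lia.
Qed.

Lemma all_one_code : vec setT \in C.
Proof.
rewrite (mem_self_dual sdC); apply/forall_inP => c /(even_wt_code sdC).
by rewrite dot_eq0 vecK setIT.
Qed.

Lemma supp_add_all_one s : supp (s + vec setT) = ~: supp s.
Proof.
by apply/setP=> i; rewrite !inE !mxE inE; case: (F2P (s 0 i)) => ->.
Qed.

Lemma wt_add_all_one s : (wt (s + vec setT) + wt s = n)%N.
Proof.
by rewrite /wt -/(supp _) -/(supp _) supp_add_all_one addnC cardsC card_ord.
Qed.

Lemma shadow_add_all_one s : (s + vec setT \in shadow C) = (s \in shadow C).
Proof.
rewrite !mem_shadow //; apply: eq_forallb_in => c Cc; congr (_ == _).
rewrite chi_sym chiD -!(chi_sym c) [X in _ * X]chi_dot.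
move: all_one_code; rewrite (mem_self_dual sdC) => /forall_inP /(_ c Cc) ->.
by rewrite mulr1.
Qed.

End ShadowWeights.

(** * Enumerator coefficients and the test polynomial *)

Lemma coef_weight_enum n (A : {pred 'rV['F_2]_n}) (i : nat) : (i <= n)%N ->
  (weight_enum A)`_i = #|[set x in A | wt x == i]|%:Z.
Proof.
move=> le_in; rewrite coef_sum (bigD1 (Ordinal (le_in : i < n.+1)%N)) //=.
rewrite coefCM coefXn eqxx mulr1 big1 ?addr0 // => j ne_ji.
rewrite coefCM coefXn (_ : (i == j :> nat) = false) ?mulr0 //.
by apply/eqP => e; case/eqP: ne_ji; apply: val_inj.
Qed.

Lemma prod_ffact (y N : nat) :
  \prod_(t < N) (y%:Z - (t : nat)%:Z) = (y ^_ N)%:Z.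
Proof.
elim: N => [|N IH]; first by rewrite big_ord0 ffactn0.
rewrite big_ord_recr /= IH ffactnSr PoszM.
case: (leqP N y) => [/subzn <- // | lt_yN].
by rewrite ffact_small // !mul0r.
Qed.

(* The roots 20, 24, ..., 84 of the test polynomial in the variable [wt s - 1];
   listed downwards so that the product is a falling factorial. *)
Definition mid_weights : seq int := [seq 4 * (21 - (t : nat)%:Z) | t : 'I_17].

Lemma prod_mid_weights (k : int) :
  \prod_(l <- mid_weights) (k - l) =
  \prod_(t < 17) (k - 4 * (21 - (t : nat)%:Z)).
Proof. by rewrite big_image. Qed.

(** Each factor equals -4 (21 - x - t). The result vanishes for 5 <= x <= 21, that is, at the
    weights 21, 25, ..., 85. *)
Lemma prod_mid_weightsE (x : nat) : (x <= 21)%N ->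
  \prod_(l <- mid_weights) ((4 * x)%N%:Z - l) =
  (- 4) ^+ 17 * ((21 - x) ^_ 17)%:Z.
Proof.
move=> le_x; rewrite prod_mid_weights -prod_ffact.
have -> : (- 4) ^+ 17 = \prod_(t < 17) - 4 :> int.
  by rewrite prodr_const card_ord.
rewrite -big_split /=.
by apply: eq_bigr => t _; rewrite -subzn // PoszM; ring.
Qed.

(** The reflection permutes the roots, and their number 17 is odd. It is complementation, wt to 106
    - wt, in the variable wt - 1. *)
Lemma prod_mid_weights_compl (k : int) :
  \prod_(l <- mid_weights) (104 - k - l) = - \prod_(l <- mid_weights) (k - l).
Proof.
rewrite !prod_mid_weights [RHS](_ : _ = (-1) ^+ 17 * \prod_(t < 17)
  (k - 4 * (21 - (t : nat)%:Z))); last by rewrite -signr_odd mulN1r.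
have -> : (- 1) ^+ 17 = \prod_(t < 17) - 1 :> int.
  by rewrite prodr_const card_ord.
rewrite -big_split /=.
rewrite (reindex_inj rev_ord_inj) /=; apply: eq_bigr => t _.
by rewrite subSS -subzn ?leq_ord //; ring.
Qed.

Lemma pow2_cancel (l m k : nat) (x y : int) :
  2 ^+ l * 2 ^+ m * x = 2 ^+ (l + m + k) * (2 * y) -> x = 2 ^+ k.+1 * y.
Proof.
rewrite exprS !exprD -(mulrA (_ * _)) (mulrA (2 ^+ k)) (mulrC (2 ^+ k)).
by apply: mulfI; rewrite mulf_neq0 ?expf_neq0.
Qed.

Lemma ffact_bin (k j : nat) : (k ^_ j)%:Z = j`!%:Z * 'C(k, j)%:Z.
Proof. by rewrite -bin_ffact PoszM mulrC. Qed.

(** For x = 1, 2, 3, 4 the values are 1140, 171, 18, 1. The case x = 0, weight 1, must be excluded: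
    C(21, 17) = 5985 is odd. *)
Lemma odd_bin_17 (x : nat) : (0 < x)%N ->
  odd 'C(21 - x, 17) = (x == 2) || (x == 4).
Proof.
move=> x_gt0; have [x_le4|x_gt4] := leqP x 4; last first.
  by rewrite bin_small; lia.
have : x \in iota 1 4 by rewrite mem_iota x_gt0.
by rewrite !inE => /or4P[] /eqP ->; vm_compute.
Qed.

(** * Parity of the shadow counts in length 106 *)

Section Length106.

Variable C : {vspace 'rV['F_2]_106}.
Hypotheses (dimC : \dim C = 53) (sdC : self_dual C) (seC : singly_even C).
Hypothesis min_wt : forall c, c \in C -> c != 0 -> (18 <= wt c)%N.
Hypothesis wt_shadow : forall s, s \in shadow C -> (5 <= wt s)%N.
Hypothesis wt_shadow_mod4 : forall s, s \in shadow C -> (wt s = 1 %[mod 4])%N.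

Lemma shadow_wtE s : s \in shadow C ->
  exists2 x, (0 < x)%N & wt s = (4 * x).+1.
Proof.
by move=> Ss; exists (wt s %/ 4)%N; have := wt_shadow Ss;
  have := wt_shadow_mod4 Ss; lia.
Qed.

Lemma card_codeE : #|C|%:Z = 2 ^+ 53.
Proof.
have natX k : (2 ^ k)%N%:Z = 2 ^+ k by rewrite -natz natrX.
by rewrite card_vspace card_Fp // dimC natX.
Qed.

(** No codeword has weight j+1, which lies strictly between 0 and 18. *)
Lemma shadow_low_moments (i : 'I_106) j : (j < 17)%N ->
  \sum_(s in shadow C) dev i (supp s) * ((wt s).-1 ^_ j)%:Z = 0.
Proof.
move=> lt_j; have := shadow_moment sdC seC min_wt i (ltnW lt_j).
rewrite [X in _ = _ * X]big_pred0 => [|c]; last first.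
  apply/negbTE/negP => /andP[Cc /eqP wtc]; have [c0|/(min_wt Cc)] := eqVneq c 0.
    by move: wtc; rewrite c0 /wt -/(supp 0) supp0 cards0.
  by rewrite wtc; lia.
rewrite mulr0 => /eqP; rewrite !mulf_eq0 expf_eq0 /= orbF.
rewrite card_codeE expf_eq0 /= => /eqP sum0.
rewrite (eq_bigr (fun s => j`!%:Z * (dev i (supp s) * 'C((wt s).-1, j)%:Z))).
  by rewrite -mulr_sumr sum0 mulr0.
by move=> s _; rewrite ffact_bin mulrCA.
Qed.

(** At weight 18, [zeta] is -1 and [dev] is even; this extra 2 improves 2^(106-53-18) = 2^35 to
    2^36. *)
Lemma shadow_moment17 (i : 'I_106) : exists t : int,
  \sum_(s in shadow C) dev i (supp s) * 'C((wt s).-1, 17)%:Z = 2 ^+ 36 * t.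
Proof.
exists (\sum_(c in C | wt c == 18) (9 - 53 * (i \in supp c)%:Z)).
have := shadow_moment sdC seC min_wt i (isT : 17 < 18)%N.
rewrite [X in _ = _ * X](eq_bigr
    (fun c => 2 * (9 - 53 * (i \in supp c)%:Z))); last first.
  move=> c /andP[_ /eqP wtc]; rewrite /zeta wtc /dev card_ord.
  rewrite -[#|supp c|]/(wt c) wtc (_ : (-1) ^+ 18 * (-1) ^+ 18./2 = -1) // mulrN1.
  by case: (i \in supp c).
rewrite -mulr_sumr card_codeE.
exact: (@pow2_cancel 53 18 35).
Qed.

(** With [q] = 17!, the moments give the total of [dev] times [Q] as q 2^36 t. Complementation
    negates both factors, so the total is also twice its part below weight 53, which is -2^34 q
    times the sum wanted. *)
Lemma even_shadow_sum (i : 'I_106) : exists t : int,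
  \sum_(s in shadow C | (wt s < 53)%N)
     dev i (supp s) * 'C(21 - wt s %/ 4, 17)%:Z = 2 * t.
Proof.
have [t momt] := shadow_moment17 i; exists (- t).
have [q q_neq0 ffactE] : exists2 q : int,
    q != 0 & forall k, (k ^_ 17)%:Z = q * 'C(k, 17)%:Z.
  exists 17`!%:Z => [|k]; first by rewrite eqz_nat -lt0n fact_gt0.
  exact: ffact_bin.
set Q := fun s : 'rV['F_2]_106 => \prod_(l <- mid_weights) ((wt s).-1%:Z - l).
have sumQ : \sum_(s in shadow C) dev i (supp s) * Q s =
    q * \sum_(s in shadow C) dev i (supp s) * 'C((wt s).-1, 17)%:Z.
  have := moment_prod (shadow_low_moments i) (ls := mid_weights) (j := 0).
  rewrite size_image card_ord addn0 eqxx => /(_ isT).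
  rewrite (eq_bigr (fun s => dev i (supp s) * Q s)) => [->|s _].
    by rewrite mulr_sumr; apply: eq_bigr => s _; rewrite ffactE; ring.
  by rewrite ffactn0 mulr1.
have sum_compl : \sum_(s in shadow C | ~~ (wt s < 53)%N) dev i (supp s) * Q s =
    \sum_(s in shadow C | (wt s < 53)%N) dev i (supp s) * Q s.
  (* Weight 53 is its own complement; [Q] vanishes there, as 52 is a root. *)
  rewrite (bigID (fun s => 53 < wt s)%N) /= [X in _ + X]big1 ?addr0; last first.
    move=> s /andP[/andP[_ ge53] le53]; rewrite /Q (_ : (wt s).-1 = 4 * 13)%N.
      by rewrite prod_mid_weightsE // ffact_small // !mulr0.
    by lia.
  rewrite (reindex_inj (addIr (vec setT))) /=; apply: eq_big => s.
    rewrite shadow_add_all_one //; case Ss: (s \in shadow C) => //=.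
    have := wt_add_all_one s; have [x _] := shadow_wtE Ss.
    by move: (wt (s + _)) (wt s) => u v ? ?; apply/idP/idP; lia.
  rewrite shadow_add_all_one // => /andP[/andP[Ss _] _].
  rewrite supp_add_all_one devC /Q.
  have -> : (wt (s + vec setT)).-1%:Z = 104 - (wt s).-1%:Z.
    have := wt_add_all_one s; have [x _ wts] := shadow_wtE Ss.
    have [y _] := shadow_wtE (etrans (shadow_add_all_one sdC seC s) Ss).
    by move: (wt (s + _)) (wt s) wts => u v; lia.
  by rewrite prod_mid_weights_compl mulrNN.
have sum_low : \sum_(s in shadow C | (wt s < 53)%N) dev i (supp s) * Q s =
    (- 4) ^+ 17 * q * \sum_(s in shadow C | (wt s < 53)%N)
     dev i (supp s) * 'C(21 - wt s %/ 4, 17)%:Z.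
  rewrite mulr_sumr; apply: eq_bigr => s /andP[Ss lts].
  have [x _ wts] := shadow_wtE Ss; rewrite /Q wts /=.
  rewrite prod_mid_weightsE; last lia.
  rewrite ffactE (_ : _ %/ 4 = x)%N; last lia.
  by move: ((- 4) ^+ 17) => p; ring.
move: sumQ; rewrite momt (bigID (fun s => wt s < 53)%N) /= sum_compl sum_low.
have -> : (- 4) ^+ 17 = - (2 ^+ 34) :> int.
  by rewrite -[34%N]/(2 * 17)%N exprM exprNn -signr_odd mulN1r.
rewrite (exprS _ 35) (exprS _ 34) => eqX.
have pow_neq0 : (2 ^+ 34 : int) != 0 by rewrite expf_neq0.
move: (2 ^+ 34) pow_neq0 eqX => p p_neq0 eqX.
have coef_neq0 : 2 * p * q != 0 by rewrite !mulf_neq0.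
apply: (mulfI coef_neq0).
transitivity (- (q * (2 * (2 * p) * t))); last by ring.
by rewrite -mulrA in eqX; rewrite -eqX; ring.
Qed.

(** Modulo 2, [dev] is 1 on odd weights because 106 is even, and the binomial is 1 exactly at
    weights 9 and 17. *)
Lemma even_shadow_9_17 :
  exists t : int, #|[set s in shadow C | wt s == 9]|%:Z +
    #|[set s in shadow C | wt s == 17]|%:Z = 2 * t.
Proof.
have [t sumt] := even_shadow_sum ord0.
pose term (s : 'rV['F_2]_106) := dev ord0 (supp s) * 'C(21 - wt s %/ 4, 17)%:Z.
pose ind (s : 'rV['F_2]_106) : int := (wt s == 9)%:Z + (wt s == 17)%:Z.
have term_mod2 s : s \in shadow C -> (wt s < 53)%N ->
    term s = ind s + 2 * ((term s - ind s) %/ 2)%Z.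
  move=> Ss lts; suff /dvdzP[q]: (2 %| term s - ind s)%Z by lia.
  have [x x_gt0 wts] := shadow_wtE Ss; rewrite /term /ind /dev.
  rewrite -[#|supp s|]/(wt s) wts card_ord (_ : _ %/ 4 = x)%N; last lia.
  rewrite -(odd_double_half 'C(21 - x, 17)) odd_bin_17 //.
  (* The binomial is its parity plus 2h; each witness below is half of (106 e - wt) times the
     binomial, minus the indicator. *)
  move: (_./2) => h; set e := Posz (ord0 \in _); rewrite PoszD -muln2 !PoszM.
  apply/dvdzP; case: eqP => [->|ne2] /=.
    by exists (106 * e * h%:Z + 53 * e - 9 * h%:Z - 5); lia.
  case: eqP => [->|ne4] /=.
    by exists (106 * e * h%:Z + 53 * e - 17 * h%:Z - 9); lia.
  exists ((106 * e - (4 * x).+1%:Z) * h%:Z); lia.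
have count_wt w : (w < 53)%N ->
    \sum_(s in shadow C | (wt s < 53)%N) (wt s == w)%:Z =
    #|[set s in shadow C | wt s == w]|%:Z.
  move=> ltw; rewrite -sum1_card -[RHS]natz natr_sum big_mkcond.
  rewrite [RHS]big_mkcond; apply: eq_bigr => s _; rewrite inE.
  case: (s \in shadow C) => //=.
  by case: (eqVneq (wt s) w) => [->|_]; [rewrite ltw | case: ifP].
exists (t - \sum_(s in shadow C | (wt s < 53)%N) ((term s - ind s) %/ 2)%Z).
rewrite -!count_wt // -big_split /= mulrBr -sumt mulr_sumr.
apply/eqP; rewrite eq_sym subr_eq -big_split; apply/eqP.
by apply: eq_bigr => s /andP[Ss lts]; apply: term_mod2.
Qed.

End Length106.

(* The dots are terms of degree at least 25, respectively 18. *)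
Theorem proposition3 (C : {vspace 'rV['F_2]_106}) (a b c d : int) :
  nkd_code 53 18 C ->
  self_dual C ->
  singly_even C ->
  (forall x, x \in shadow C -> (5 <= wt x)%N) ->
  take_poly 25 (weight_enum C) =
    1 + (35245%:Z + 2 * d)%:P * 'X^18
      + (416262%:Z + 128 * c - 2 * d)%:P * 'X^20
      + (6586310%:Z + 8192%:Z * b - 896 * c - 34 * d)%:P * 'X^22
      + (86626645%:Z + 524288%:Z * a - 106496%:Z * b + 1024 * c + 34 * d)%:P * 'X^24 ->
  take_poly 18 (weight_enum (shadow C)) =
    a%:P * 'X^5
      + (- 24 * a - b)%:P * 'X^9
      + (276 * a + 22 * b + c)%:P * 'X^13
      + (- 2024 * a - 231 * b - 20 * c - d)%:P * 'X^17 ->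
  (2 %| d)%Z.
Proof.
move=> [dimC [_ min_wt]] sdC seC wt_shadow _ enumS.
have coef_sparse (p q r u : int) :
    let P := p%:P * 'X^5 + q%:P * 'X^9 + r%:P * 'X^13 + u%:P * 'X^17 in
    P`_9 = q /\ P`_17 = u.
  by rewrite /= !coefD !coefCM !coefXn /= !mulr0 !mulr1 !addr0 !add0r.
have countS i : (i < 18)%N -> #|[set s in shadow C | wt s == i]|%:Z =
    (take_poly 18 (weight_enum (shadow C)))`_i.
  by move=> lti; rewrite coef_take_poly lti coef_weight_enum //; lia.
have [q9 u17] := coef_sparse a (- 24 * a - b) (276 * a + 22 * b + c)
  (- 2024 * a - 231 * b - 20 * c - d).
have B9 := countS 9%N isT; have B17 := countS 17%N isT.
rewrite enumS q9 in B9; rewrite enumS u17 in B17.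
have [t even_sum] : exists t : int, #|[set s in shadow C | wt s == 9]|%:Z +
    #|[set s in shadow C | wt s == 17]|%:Z = 2 * t.
  (* All shadow weights are in fact 1 mod 4; proving this is avoided, since in
     the other case both counts are 0. *)
  have [/exists_inP[s0 Ss0 /eqP wts0]|/exists_inPn none] :=
      boolP [exists s in shadow C, wt s %% 4 == 1]%N.
    apply: even_shadow_9_17 => // s Ss.
    by rewrite (shadow_wt_mod4 sdC seC Ss Ss0) wts0.
  have count0 w : (w %% 4 = 1)%N -> #|[set s in shadow C | wt s == w]| = 0%N.
    move=> w1; apply/eqP; rewrite cards_eq0; apply/set0Pn => -[s].
    by rewrite inE => /andP[/none + /eqP wts]; rewrite wts w1.
  by exists 0; rewrite !count0.
rewrite B9 B17 in even_sum; clear - even_sum.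
(* The prescribed coefficients give B_9 + B_17 = -2048 a - 232 b - 20 c - d. *)
by apply/dvdzP; exists (- 1024 * a - 116 * b - 10 * c - t); lia.
Qed.
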